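(* Let $G$ and $H$ be finite graphs. Then $G$ and $H$ are strongly relationally equivalent if and only if their point-determining graphs $G_{\mathrm{pd}}$ and $H_{\mathrm{pd}}$ are isomorphic.
   Context: Graphs are finite and undirected, loops allowed. For a finite set $B$ and a relation $R\subseteq V_G\times B$ with full image (every $b\in B$ has some $v$ with $(v,b)\in R$), $G\ast R$ is the graph with vertex set $B$ and edge set $\{(a,b)\in B\times B: \exists (u,v)\in E_G,\ (u,a)\in R,\ (v,b)\in R\}$. All relations here are required to have full domain (every $v\in V_G$ is related to some $b\in B$). $R^+$ is the transpose of $R$. $G$ and $H$ are strongly relationally equivalent if there is a relation $R\subseteq V_G\times V_H$ with $G\ast R=H$ and $H\ast R^+=G$. $N_G(x)$ is the set of vertices adjacent to $x$ (containing $x$ iff $x$ has a loop). The point-determining graph $G_{\mathrm{pd}}$ has as vertices the classes of the equivalence relation $x\sim y\iff N_G(x)=N_G(y)$ on $V_G$; two classes $\sigma,\tau$ (possibly equal) are adjacent iff there are $x\in\sigma$, $y\in\tau$ with $(x,y)\in E_G$. *)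

(* Defs.v *)
From mathcomp Require Import all_boot.

Set Implicit Arguments.
Unset Strict Implicit.
Unset Printing Implicit Defensive.

(* Finite undirected graphs: loops are allowed, since [adj] need not be
   irreflexive, and the vertex set may be empty. *)
Record graph := Graph {
  vertex :> finType;
  adj : rel vertex;
  adj_sym : symmetric adj
}.

Definition transpose (A B : Type) (R : A -> B -> bool) : B -> A -> bool :=
  fun b a => R a b.

Definition full_domain (A B : Type) (R : A -> B -> bool) : Prop :=
  forall a : A, exists b : B, R a b.

Definition full_image (A B : Type) (R : A -> B -> bool) : Prop :=
  forall b : B, exists a : A, R a b.

Definition star_adj (G : graph) (B : finType) (R : G -> B -> bool) : rel B :=
  fun a b => [exists u : G, exists v : G, [&& adj u v, R u a & R v b]].

Lemma star_adj_sym (G : graph) (B : finType) (R : G -> B -> bool) :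
  symmetric (star_adj R).
Proof.
move=> a b; apply/idP/idP => /existsP[u /existsP[v /and3P[Euv Ru Rv]]];
  by apply/existsP; exists v; apply/existsP; exists u; rewrite adj_sym Euv Rv.
Qed.

(* The graph G * R on the vertex set B. It is defined for every relation R;
   full image and full domain are imposed in [strongly_rel_equiv]. *)
Definition star (G : graph) (B : finType) (R : G -> B -> bool) : graph :=
  Graph (star_adj_sym R).

(* [star R] has the same vertex type as H, and [star (transpose R)] the same
   as G, so equality of graphs (not mere isomorphism) is pointwise equality of
   the adjacency relations. *)
Definition strongly_rel_equiv (G H : graph) : Prop :=
  exists R : G -> H -> bool,
    [/\ full_domain R,
        full_image R,
        @adj (star R) =2 @adj H
      & @adj (star (transpose R)) =2 @adj G].

Definition nbhd (G : graph) (x : G) : {set G} := [set y | adj x y].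

Definition pd_classes (G : graph) : {set {set G}} :=
  preim_partition (@nbhd G) [set: G].

Definition pd_vertex (G : graph) : finType :=
  {sigma : {set G} | sigma \in pd_classes G}.

Definition pd_adj (G : graph) : rel (pd_vertex G) :=
  fun sigma tau =>
    [exists x in val sigma, exists y in val tau, adj x y].

Lemma pd_adj_sym (G : graph) : symmetric (@pd_adj G).
Proof.
move=> s t; apply/idP/idP => /exists_inP[x xs /exists_inP[y yt Exy]];
  by apply/exists_inP; exists y => //; apply/exists_inP; exists x;
     rewrite // adj_sym.
Qed.

Definition point_determining (G : graph) : graph := Graph (@pd_adj_sym G).

Definition isomorphic (G H : graph) : Prop :=
  exists2 f : G -> H, bijective f & forall x y : G, adj (f x) (f y) = adj x y.

(* Main.v *)
Require Import Defs.
From mathcomp Require Import all_boot.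

(** Suppose x R a and y R b. Then G * R = H makes a adjacent to b whenever x is
    adjacent to y, and H * R^+ = G gives the converse. So a strong equivalence
    is exactly a relation with full domain and image that preserves and
    reflects adjacency. Such a relation induces a bijection of neighbourhood
    classes, and conversely an isomorphism f of the point-determining graphs
    yields the relation f [x] = [y]. *)

Set Implicit Arguments.
Unset Strict Implicit.
Unset Printing Implicit Defensive.

Definition compatible (G H : graph) (R : G -> H -> bool) : Prop :=
  forall x y a b, R x a -> R y b -> adj x y = adj a b.

Lemma compatible_transpose (G H : graph) (R : G -> H -> bool) :
  compatible R -> compatible (transpose R).
Proof. by move=> cR a b x y Rxa Ryb; rewrite (cR x y a b). Qed.

Lemma star_adjP (G : graph) (B : finType) (R : G -> B -> bool) a b :
  reflect (exists x y, [/\ adj x y, R x a & R y b]) (star_adj R a b).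
Proof.
apply: (iffP existsP) => [[x /existsP[y /and3P[Exy Rx Ry]]] | [x [y [Exy Rx Ry]]]].
  by exists x, y.
by exists x; apply/existsP; exists y; rewrite Exy Rx.
Qed.

(** Full image supplies preimages of adjacent [a] and [b], which compatibility makes adjacent. *)
Lemma compatible_star (G H : graph) (R : G -> H -> bool) :
  full_image R -> compatible R -> @adj (star R) =2 @adj H.
Proof.
move=> imR cR a b; apply/star_adjP/idP => [[x [y [Exy Rx Ry]]] | Eab].
  by rewrite -(cR x y).
have [[x Rx] [y Ry]] := (imR a, imR b).
by exists x, y; rewrite (cR x y a b).
Qed.

Lemma strongly_rel_equivP (G H : graph) :
  strongly_rel_equiv G H <->
  exists R : G -> H -> bool, [/\ full_domain R, full_image R & compatible R].
Proof.
split=> [[R [dR iR sR sRt]] | [R [dR iR cR]]]; exists R; split=> //.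
- move=> x y a b Rx Ry; apply/idP/idP => E.
    by rewrite -sR; apply/star_adjP; exists x, y.
  by rewrite -sRt; apply/star_adjP; exists a, b.
- exact: compatible_star.
(* The full domain of [R] is the full image of its transpose. *)
- by apply: compatible_star => //; apply: compatible_transpose.
Qed.

(** Any test vertex [c] of [H] pulls back to some [z] in [G], where [x] and [y] cannot be told
    apart. *)
Lemma compatible_nbhd (G H : graph) (R : G -> H -> bool) x y a b :
  full_image R -> compatible R -> R x a -> R y b ->
  nbhd x = nbhd y -> nbhd a = nbhd b.
Proof.
move=> imR cR Rx Ry /setP eqN; apply/setP=> c; have [z Rz] := imR c.
by have:= eqN z; rewrite !inE (cR x z a c) // (cR y z b c).
Qed.

Section NeighbourhoodClass.

Variable G : graph.

Let eqvN : {in [set: G] & &, equivalence_rel [rel x y | nbhd x == nbhd y]}.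
Proof. by move=> x y z _ _ _; split=> //= /eqP->. Qed.

Lemma pd_class_subproof (x : G) : pblock (pd_classes G) x \in pd_classes G.
Proof.
by apply: pblock_mem; rewrite (cover_partition (preim_partitionP _ _)) inE.
Qed.

Definition pd_class (x : G) : point_determining G :=
  exist (fun s => s \in pd_classes G) _ (pd_class_subproof x).

Lemma mem_pd_class (x y : G) : (y \in val (pd_class x)) = (nbhd x == nbhd y).
Proof. by rewrite /= (pblock_equivalence_partition eqvN) ?inE. Qed.

Lemma pd_class_eqP (x y : G) : reflect (nbhd x = nbhd y) (pd_class x == pd_class y).
Proof.
apply: (iffP eqP) => [eqC | eqN].
  by apply/eqP; rewrite -mem_pd_class eqC mem_pd_class.
have /and3P[_ tiP _] := preim_partitionP (@nbhd G) [set: G].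
apply: val_inj; apply: esym; apply: (same_pblock tiP).
by have:= mem_pd_class x y; rewrite eqN eqxx.
Qed.

(** Blocks of a partition are nonempty. The boolean equality lets [xchoose] pick representatives
    later. *)
Lemma pd_class_surj (s : point_determining G) : exists x, pd_class x == s.
Proof.
have /and3P[_ tiP n0P] := preim_partitionP (@nbhd G) [set: G].
have [x xs]: exists x, x \in val s.
  by apply/set0Pn; apply: contraNneq n0P => <-; apply: valP.
by exists x; apply/eqP/val_inj; apply: (def_pblock tiP (valP s)).
Qed.

Lemma adj_pd_class (x y : G) : adj (pd_class x) (pd_class y) = adj x y.
Proof.
apply/exists_inP/idP => [[u xu /exists_inP[v yv Euv]] | Exy].
  move: xu yv; rewrite !mem_pd_class => /eqP/setP xu /eqP/setP yv.
  (* Exchange [u] for [x], then [v] for [y], in the edge from [u] to [v]. *)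
  have:= xu v; rewrite !inE Euv adj_sym => Evx.
  by have:= yv x; rewrite !inE Evx adj_sym.
exists x; first by rewrite mem_pd_class.
by apply/exists_inP; exists y; rewrite ?mem_pd_class.
Qed.

End NeighbourhoodClass.

(** Choose a representative of the class, then a vertex related to it; by [compatible_nbhd] the
    resulting class does not depend on either choice. *)
Lemma compatible_pd_map (G H : graph) (R : G -> H -> bool) :
  full_domain R -> full_image R -> compatible R ->
  exists f : point_determining G -> point_determining H,
    forall x a, R x a -> f (pd_class x) = pd_class a.
Proof.
move=> dR iR cR; pose r s := xchoose (@pd_class_surj G s).
exists (fun s => pd_class (xchoose (dR (r s)))) => x a Rxa.
apply/eqP/pd_class_eqP.
apply: (compatible_nbhd iR cR (xchooseP (dR _)) Rxa).
exact/pd_class_eqP/(xchooseP (pd_class_surj _)).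
Qed.

Theorem theorem4p2p4 (G H : graph) :
  strongly_rel_equiv G H <->
  isomorphic (point_determining G) (point_determining H).
Proof.
split=> [/strongly_rel_equivP[R [dR iR cR]] | [f [g fK gK] f_adj]].
  have [f fE] := compatible_pd_map dR iR cR.
  (* The transpose induces the inverse map. *)
  have [g gE] := compatible_pd_map iR dR (compatible_transpose cR).
  exists f.
    exists g => s; have [x /eqP<-] := pd_class_surj s.
      by have [a Rxa] := dR x; rewrite (fE x a) ?(gE a x).
    by have [y Ryx] := iR x; rewrite (gE x y) ?(fE y x).
  move=> s t; have [[x /eqP<-] [y /eqP<-]] := (pd_class_surj s, pd_class_surj t).
  have [[a Rxa] [b Ryb]] := (dR x, dR y).
  by rewrite (fE x a) // (fE y b) // !adj_pd_class (cR x y a b).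
apply/strongly_rel_equivP.
exists (fun x a => f (pd_class x) == pd_class a); split.
- move=> x; have [a /eqP<-] := pd_class_surj (f (pd_class x)).
  by exists a.
- move=> a; have [x /eqP xE] := pd_class_surj (g (pd_class a)).
  by exists x; rewrite xE gK.
- move=> x y a b /eqP xa /eqP yb.
  (* Adjacency is read off on classes, where [f] preserves it. *)
  by rewrite -(adj_pd_class a) -xa -yb f_adj adj_pd_class.
Qed.
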